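(* Let $\{w^k\}$, $w^k=(x^k,y^k,\lambda^k)$, be a sequence generated by the iPSPR iteration with $(\alpha,\gamma)\in\mathbb D$ and symmetric (possibly indefinite) proximal matrices $S,T$. Suppose that $$S+\tfrac12\Sigma_1\succeq 0,\qquad S+\tfrac12\Sigma_1+\beta A^{\mathsf T}A\succ 0,$$ $$T+\Sigma_2+(1-\alpha)\beta B^{\mathsf T}B\succ 0,\qquad T+\tfrac12\Sigma_2+\kappa_1^{\alpha,\gamma}(-2T_-+\Sigma_2)+\kappa_2^{\alpha,\gamma}\beta B^{\mathsf T}B\succ 0,$$ and $$S+\tfrac12\Sigma_1\succeq\tfrac12 c\,\Sigma_1$$ for some constant $c>0$. Then, as $t\to\infty$, $$\min_{1\le i\le t}\|w^i-w^{i+1}\|_{\widehat G}^2=o(1/t).$$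
   Context: **Problem.** $\min\ \theta_1(x)+\theta_2(y)$ s.t. $Ax+By=b$, $x\in\mathcal X=\mathbb R^{n_1}$, $y\in\mathcal Y=\mathbb R^{n_2}$, with $A\in\mathbb R^{m\times n_1}$, $B\in\mathbb R^{m\times n_2}$, $b\in\mathbb R^m$. Here $\theta_1=p+f$, $\theta_2=h+g$, where $p:\mathcal X\to(-\infty,+\infty]$, $h:\mathcal Y\to(-\infty,+\infty]$ are proper closed convex and $f:\mathcal X\to\mathbb R$, $g:\mathcal Y\to\mathbb R$ are convex with Lipschitz continuous gradients. Let $\Omega=\mathcal X\times\mathcal Y\times\mathbb R^m$, $w=(x,y,\lambda)$. $\Omega^*$ is the set of primal-dual optimal solutions: $w^*=(x^*,y^*,\lambda^* )$ with $Ax^*+By^*=b$, $A^{\mathsf T}\lambda^*\in\partial\theta_1(x^* )$, $B^{\mathsf T}\lambda^*\in\partial\theta_2(y^* )$. It is assumed that $\Omega^*\neq\emptyset$. **Convexity matrices.** $\Sigma_1,\Sigma_2$ are fixed symmetric positive semidefinite matrices with $\langle x-x',\xi_x-\xi_x'\rangle\ge\|x-x'\|_{\Sigma_1}^2$ for all $x,x'$, $\xi_x\in\partial\theta_1(x)$, $\xi_x'\in\partial\theta_1(x')$, and $\langle y-y',\xi_y-\xi_y'\rangle\ge\|y-y'\|_{\Sigma_2}^2$ for all $y,y'$, $\xi_y\in\partial\theta_2(y)$, $\xi_y'\in\partial\theta_2(y')$. For symmetric (possibly indefinite) $G$, $\|z\|_G^2:=z^{\mathsf T}Gz$. **iPSPR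 iteration.** Let $\beta>0$ and $\mathcal L_\beta(x,y,\lambda)=\theta_1(x)+\theta_2(y)-\langle\lambda,Ax+By-b\rangle+\frac\beta2\|Ax+By-b\|^2$. Given $w^0\in\Omega$, for $k\ge 0$: $x^{k+1}=\arg\min_{x\in\mathcal X}\mathcal L_\beta(x,y^k,\lambda^k)+\frac12\|x-x^k\|_S^2$; $\lambda^{k+1/2}=\lambda^k-\alpha\beta(Ax^{k+1}+By^k-b)$; $y^{k+1}=\arg\min_{y\in\mathcal Y}\mathcal L_\beta(x^{k+1},y,\lambda^{k+1/2})+\frac12\|y-y^k\|_T^2$; $\lambda^{k+1}=\lambda^{k+1/2}-\gamma\beta(Ax^{k+1}+By^{k+1}-b)$. $S,T$ are symmetric; $T=T_+-T_-$ is a fixed decomposition with $T_+\succeq0$, $T_-\succeq0$. **Matrix $\widehat G$.** $$\widehat G=\begin{pmatrix}S+\Sigma_1&0&0\\0&T+\Sigma_2+\frac{\alpha+\gamma-\alpha\gamma}{\alpha+\gamma}\beta B^{\mathsf T}B&-\frac{\alpha}{\alpha+\gamma}B^{\mathsf T}\\0&-\frac{\alpha}{\alpha+\gamma}B&\frac1{(\alpha+\gamma)\beta}I_m\end{pmatrix}.$$ **Stepsize domain.** $\mathbb D=\{(\alpha,\gamma):0\le\alpha<1,\ 0\le\gamma<\frac{1-\alpha+\sqrt{(1+\alpha)^2+4(1-\alpha^2)}}2,\ \alpha+\gamma>0\}=\mathbb D_1\cup\mathbb D_2\cup\mathbb D_3\cup\mathbb D_4$, with $\mathbb D_1=\{0\le\alpha<1<\gamma<\frac{1-\alpha+\sqrt{(1+\alpha)^2+4(1-\alpha^2)}}2\}$,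 $\mathbb D_2=\{0\le\alpha<1,\gamma=1\}$, $\mathbb D_3=\{0\le\alpha<1,0\le\gamma<1,\alpha+\gamma>0,\alpha\ne\gamma\}$, $\mathbb D_4=\{0<\alpha=\gamma<1\}$. **Constants.** $c^{\alpha,\gamma}$ is a fixed number in $\left(0,\frac{1-\alpha^2+\alpha-(\alpha-1)\gamma-\gamma^2}{(2-\alpha-\gamma)(1+\alpha)}\right)$ if $(\alpha,\gamma)\in\mathbb D_1$ and in $(0,1)$ if $(\alpha,\gamma)\in\mathbb D_2\cup\mathbb D_3$ (not needed on $\mathbb D_4$). $\kappa_1^{\alpha,\gamma}=\frac{2(1-\alpha)}{1+\alpha}$ on $\mathbb D_1$, $\frac{1-\alpha}{1+\alpha}$ on $\mathbb D_2$, $0$ on $\mathbb D_3\cup\mathbb D_4$. $\kappa_2^{\alpha,\gamma}=\frac{c^{\alpha,\gamma}(1-\alpha)^2}{1+\alpha}$ on $\mathbb D_1$, $\frac{c^{\alpha,\gamma}(1-\alpha)(3-\alpha)}{4(1+\alpha)}$ on $\mathbb D_2$, $\frac{c^{\alpha,\gamma}(1-\alpha)(1-\gamma)}{2-\gamma-\alpha}$ on $\mathbb D_3$, $\frac{1-\alpha}2$ on $\mathbb D_4$. *)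

(* Defs.v *)
(* A point of R^n is a column vector 'cV[R]_n. *)
From HB Require Import structures.
From mathcomp Require Import all_boot all_order all_algebra.
From mathcomp Require Import all_classical all_reals all_analysis.

Set Implicit Arguments.
Unset Strict Implicit.
Unset Printing Implicit Defensive.

Import Order.TTheory GRing.Theory Num.Theory.
Import numFieldNormedType.Exports.

Local Open Scope classical_set_scope.
Local Open Scope ring_scope.

Section Euclidean.
Context {R : realType}.

Definition dotv n (u v : 'cV[R]_n) : R := (u^T *m v) 0 0.

(* The library norm `|u| of a matrix is the sup norm, hence this definition. *)
Definition enorm n (u : 'cV[R]_n) : R := Num.sqrt (dotv u u).

(* ||z||_G^2 = z^T G z, possibly negative *)
Definition quad n (G : 'M[R]_n) (z : 'cV[R]_n) : R := (z^T *m G *m z) 0 0.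

Definition psd n (G : 'M[R]_n) : Prop :=
  G \is symmetricmx /\ forall z, 0 <= quad G z.

Definition pd n (G : 'M[R]_n) : Prop :=
  G \is symmetricmx /\ forall z, z != 0 -> 0 < quad G z.

End Euclidean.

Section Convex.
Context {R : realType} {n : nat}.
Implicit Types (p theta : 'cV[R]_n -> \bar R) (f : 'cV[R]_n -> R).

Definition epigraph p : set ('cV[R]_n * R^o) :=
  [set z | (p z.1 <= (z.2 : R)%:E)%E].

Definition proper_closed_convex p : Prop :=
  [/\ forall x, p x != -oo%E,
      exists x, (p x < +oo)%E,
      closed (epigraph p) &
      convex_set (epigraph p)].

Definition gradient f (x : 'cV[R]_n) : 'cV[R]_n :=
  \col_i ('D_(delta_mx i 0) (f : 'cV[R]_n -> R^o) x : R).

Definition lipschitz_gradient f : Prop :=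
  (forall x, differentiable (f : 'cV[R]_n -> R^o) x) /\
  exists L : R, forall x x',
    enorm (gradient f x - gradient f x') <= L * enorm (x - x').

Definition smooth_convex f : Prop :=
  convex_function [set: convex_lmodType 'cV[R]_n] f /\ lipschitz_gradient f.

(* For a proper theta this set is empty outside the effective domain. *)
Definition subdifferential theta (x : 'cV[R]_n) : set 'cV[R]_n :=
  [set xi | forall z, (theta x + (dotv xi (z - x))%:E <= theta z)%E].

Definition convexity_matrix theta (Sigma : 'M[R]_n) : Prop :=
  psd Sigma /\
  forall x x' xi xi', subdifferential theta x xi ->
    subdifferential theta x' xi' ->
    quad Sigma (x - x') <= dotv (x - x') (xi - xi').

Definition is_argmin (F : 'cV[R]_n -> \bar R) (x : 'cV[R]_n) : Prop :=
  forall z, (F x <= F z)%E.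

End Convex.

Section Problem.
Context {R : realType} {n1 n2 m : nat}.

Definition kkt_set (theta1 : 'cV[R]_n1 -> \bar R) (theta2 : 'cV[R]_n2 -> \bar R)
    (A : 'M[R]_(m, n1)) (B : 'M[R]_(m, n2)) (b : 'cV[R]_m) :
    set ('cV[R]_n1 * 'cV[R]_n2 * 'cV[R]_m) :=
  [set w | [/\ A *m w.1.1 + B *m w.1.2 = b,
               subdifferential theta1 w.1.1 (A^T *m w.2) &
               subdifferential theta2 w.1.2 (B^T *m w.2)]].

Definition aug_lagrangian (theta1 : 'cV[R]_n1 -> \bar R)
    (theta2 : 'cV[R]_n2 -> \bar R)
    (A : 'M[R]_(m, n1)) (B : 'M[R]_(m, n2)) (b : 'cV[R]_m) (beta : R)
    (x : 'cV[R]_n1) (y : 'cV[R]_n2) (lam : 'cV[R]_m) : \bar R :=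
  let r := A *m x + B *m y - b in
  (theta1 x + theta2 y - (dotv lam r)%:E + (beta / 2 * enorm r ^+ 2)%:E)%E.

(* The term theta2 (y k) does not depend on the variable of the x-subproblem and
   is dropped from it, by putting 0 for theta2: theta2 (y 0) may be +oo, as the
   starting point is arbitrary, and the full augmented Lagrangian would then be
   identically +oo in x.  By [is_argmin_drop] nothing changes when theta2 (y k)
   is finite.  In the y-subproblem theta1 (x k.+1) is always finite when theta1
   is proper. *)
Definition iPSPR (theta1 : 'cV[R]_n1 -> \bar R) (theta2 : 'cV[R]_n2 -> \bar R)
    (A : 'M[R]_(m, n1)) (B : 'M[R]_(m, n2)) (b : 'cV[R]_m)
    (beta alpha gamma : R) (S : 'M[R]_n1) (T : 'M[R]_n2)
    (x : nat -> 'cV[R]_n1) (y : nat -> 'cV[R]_n2) (lam : nat -> 'cV[R]_m) : Prop :=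
  forall k,
    let lamh := lam k - (alpha * beta) *: (A *m x k.+1 + B *m y k - b) in
    [/\ is_argmin (fun u =>
            aug_lagrangian theta1 (cst 0) A B b beta u (y k) (lam k)
            + (2^-1 * quad S (u - x k))%:E)%E (x k.+1),
        is_argmin (fun v =>
            aug_lagrangian theta1 theta2 A B b beta (x k.+1) v lamh
            + (2^-1 * quad T (v - y k))%:E)%E (y k.+1) &
        lam k.+1 = lamh - (gamma * beta) *: (A *m x k.+1 + B *m y k.+1 - b)].

Lemma is_argmin_drop (theta1 : 'cV[R]_n1 -> \bar R) (theta2 : 'cV[R]_n2 -> \bar R)
    (A : 'M[R]_(m, n1)) (B : 'M[R]_(m, n2)) (b : 'cV[R]_m) (beta : R)
    (S : 'M[R]_n1) (xk x : 'cV[R]_n1) (yk : 'cV[R]_n2) (lamk : 'cV[R]_m) :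
  theta2 yk \is a fin_num ->
  is_argmin (fun u => aug_lagrangian theta1 theta2 A B b beta u yk lamk
                      + (2^-1 * quad S (u - xk))%:E)%E x <->
  is_argmin (fun u => aug_lagrangian theta1 (cst 0) A B b beta u yk lamk
                      + (2^-1 * quad S (u - xk))%:E)%E x.
Proof.
move=> th2fin; rewrite /is_argmin.
have E v : (aug_lagrangian theta1 theta2 A B b beta v yk lamk
             + (2^-1 * quad S (v - xk))%:E =
           theta2 yk + (aug_lagrangian theta1 (cst 0) A B b beta v yk lamk
             + (2^-1 * quad S (v - xk))%:E))%E.
  by rewrite /aug_lagrangian /= adde0 -!addeA addeCA.
by split=> H z; have := H z; rewrite !E leeD2lE.
Qed.

Definition Ghat (B : 'M[R]_(m, n2)) (beta alpha gamma : R)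
    (S Sigma1 : 'M[R]_n1) (T Sigma2 : 'M[R]_n2) : 'M[R]_(n1 + (n2 + m)) :=
  block_mx
    (S + Sigma1) 0
    0 (block_mx
         (T + Sigma2
          + ((alpha + gamma - alpha * gamma) / (alpha + gamma) * beta) *: (B^T *m B))
         (- (alpha / (alpha + gamma)) *: B^T)
         (- (alpha / (alpha + gamma)) *: B)
         ((alpha + gamma) * beta)^-1%:M).

End Problem.

Section Stepsizes.
Context {R : realType}.
Implicit Types alpha gamma cag : R.

Definition gamma_bound alpha : R :=
  (1 - alpha + Num.sqrt ((1 + alpha) ^+ 2 + 4 * (1 - alpha ^+ 2))) / 2.

Definition inD alpha gamma : bool :=
  [&& 0 <= alpha < 1, 0 <= gamma < gamma_bound alpha & 0 < alpha + gamma].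

Definition inD1 alpha gamma : bool :=
  (0 <= alpha < 1) && (1 < gamma < gamma_bound alpha).

Definition inD2 alpha gamma : bool := (0 <= alpha < 1) && (gamma == 1).

Definition inD3 alpha gamma : bool :=
  [&& 0 <= alpha < 1, 0 <= gamma < 1, 0 < alpha + gamma & alpha != gamma].

Definition inD4 alpha gamma : bool := (0 < alpha < 1) && (alpha == gamma).

(* cag is the constant c^{alpha,gamma}; it is unconstrained, and unused, on D4. *)
Definition c_range alpha gamma cag : Prop :=
  (inD1 alpha gamma ->
     0 < cag < (1 - alpha ^+ 2 + alpha - (alpha - 1) * gamma - gamma ^+ 2)
               / ((2 - alpha - gamma) * (1 + alpha))) /\
  (inD2 alpha gamma || inD3 alpha gamma -> 0 < cag < 1).

Definition kappa1 alpha gamma : R :=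
  if inD1 alpha gamma then 2 * (1 - alpha) / (1 + alpha)
  else if inD2 alpha gamma then (1 - alpha) / (1 + alpha)
  else 0.

Definition kappa2 alpha gamma cag : R :=
  if inD1 alpha gamma then cag * (1 - alpha) ^+ 2 / (1 + alpha)
  else if inD2 alpha gamma then
    cag * (1 - alpha) * (3 - alpha) / (4 * (1 + alpha))
  else if inD3 alpha gamma then
    cag * (1 - alpha) * (1 - gamma) / (2 - gamma - alpha)
  else (1 - alpha) / 2.

(* min_{1 <= i <= t} a_i, for t >= 1 *)
Definition running_min (a : nat -> R) (t : nat) : R :=
  \big[Num.min/a 1%N]_(1 <= i < t.+1) a i.

End Stepsizes.

(* Main.v *)
Require Import Defs.
From HB Require Import structures.
From mathcomp Require Import all_boot all_order all_algebra.
From mathcomp Require Import all_classical all_reals all_analysis.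
From mathcomp Require Import ring lra zify.

Set Implicit Arguments.
Unset Strict Implicit.
Unset Printing Implicit Defensive.

Import Order.TTheory GRing.Theory Num.Theory.
Import numFieldNormedType.Exports.

Local Open Scope classical_set_scope.
Local Open Scope ring_scope.

(** Write [r] for the residual [A x + B y - b] after a step and [dx], [dy] for
    the increments of the primal variables.

    Each iterate minimises a convex function plus a quadratic, so the
    first-order condition ([argmin_first_order]) makes minus the gradient of the
    quadratic a subgradient; no convexity of the quadratic is needed, which is
    what allows indefinite [S] and [T]. Pairing these subgradients with a saddle
    point [ws] and using the monotonicity with moduli [Sigma1], [Sigma2] gives
    ([Ghat_descent]) that [quad Ghat (w - ws)] decreases by at least
[[
  |dx|^2_(S + Sigma1/2) + |dy|^2_(T + Sigma2/2)
    + beta ((1 - al) |B dy|^2 + (2 - al - ga) |r|^2 - 2 (1 - al) <B dy, r>).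
]]
    The bracket is a positive semidefinite form in [(B dy, r)] exactly when
    [ga <= 1], and degenerates at [ga = 1]. For [ga >= 1] the cross term is
    therefore bounded from below by a second use of monotonicity, between two
    consecutive [y]-subgradients ([cross_term_bound]); this costs the term
    [kappa1 (- 2 Tm + Sigma2)] and leaves differences that telescope. In all
    cases ([dissipation]) the bracket supplies [kappa2 |B dy|^2] together with a
    positive multiple of [|r - mu B dy|^2] for some weight [mu]. Adding the
    telescoping terms to [quad Ghat (w - ws)] gives a nonnegative potential whose
    decrease dominates a positive multiple of
[[
  |dx|^2_(S + Sigma1/2) + |dy|^2_P + |r - mu B dy|^2,
]]
    where [P] is the positive definite matrix built with [kappa1] and [kappa2].

    On the other hand [Ghat] is block diagonal in the variables [(dx, dy, r)]:
    [quad Ghat (w^k - w^(k+1))] is a combination of [|dx|^2_(S + Sigma1)],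
    [|dy|^2_(T + Sigma2)], [|B dy|^2] and [|r|^2] ([Ghat_quad]), which also shows
    that [Ghat] is positive semidefinite. The hypothesis on [c] controls the
    first term by [|dx|^2_(S + Sigma1/2)], and positive definiteness of [P]
    controls every quadratic form in [dy] ([pd_dominates]). The squared increments
    are thus summable ([iPSPR_potential]), and running minima of a nonnegative
    summable sequence are [o(1/t)] ([running_min_littleo]). *)

Section Splitting.
Context {R : realType}.
Implicit Types (n m : nat).

(** * Inner products and quadratic forms *)

Lemma dotvE n (u v : 'cV[R]_n) : dotv u v = \sum_i u i 0 * v i 0.
Proof. by rewrite /dotv mxE; apply: eq_bigr => i _; rewrite mxE. Qed.

Lemma dotvC n (u v : 'cV[R]_n) : dotv u v = dotv v u.
Proof. by rewrite !dotvE; apply: eq_bigr => i _; rewrite mulrC. Qed.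

Lemma dotvDr n (u v w : 'cV[R]_n) : dotv u (v + w) = dotv u v + dotv u w.
Proof. by rewrite /dotv mulmxDr mxE. Qed.

Lemma dotvDl n (u v w : 'cV[R]_n) : dotv (v + w) u = dotv v u + dotv w u.
Proof. by rewrite dotvC dotvDr !(dotvC u). Qed.

Lemma dotvZr n a (u v : 'cV[R]_n) : dotv u (a *: v) = a * dotv u v.
Proof. by rewrite /dotv -scalemxAr mxE. Qed.

Lemma dotvZl n a (u v : 'cV[R]_n) : dotv (a *: u) v = a * dotv u v.
Proof. by rewrite dotvC dotvZr dotvC. Qed.

Lemma dotvNr n (u v : 'cV[R]_n) : dotv u (- v) = - dotv u v.
Proof. by rewrite -scaleN1r dotvZr mulN1r. Qed.

Lemma dotvNl n (u v : 'cV[R]_n) : dotv (- u) v = - dotv u v.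
Proof. by rewrite dotvC dotvNr dotvC. Qed.

Definition dotv_lin := (dotvDl, dotvDr, dotvNl, dotvNr, dotvZl, dotvZr).

Lemma dotv_trmx n m (M : 'M[R]_(m, n)) u v :
  dotv u (M^T *m v) = dotv (M *m u) v.
Proof. by rewrite /dotv trmx_mul mulmxA. Qed.

Lemma dotv_col n m (u1 v1 : 'cV[R]_n) (u2 v2 : 'cV[R]_m) :
  dotv (col_mx u1 u2) (col_mx v1 v2) = dotv u1 v1 + dotv u2 v2.
Proof. by rewrite /dotv tr_col_mx mul_row_col mxE. Qed.

Lemma dotv_ge0 n (u : 'cV[R]_n) : 0 <= dotv u u.
Proof. by rewrite dotvE sumr_ge0// => i _; rewrite -expr2 sqr_ge0. Qed.

Lemma sqr_enorm n (u : 'cV[R]_n) : enorm u ^+ 2 = dotv u u.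
Proof. by rewrite sqr_sqrtr// dotv_ge0. Qed.

Lemma quadE n (G : 'M[R]_n) z : quad G z = dotv z (G *m z).
Proof. by rewrite /quad /dotv mulmxA. Qed.

Lemma quadDm n (G H : 'M[R]_n) z : quad (G + H) z = quad G z + quad H z.
Proof. by rewrite !quadE mulmxDl dotvDr. Qed.

Lemma quadZm n a (G : 'M[R]_n) z : quad (a *: G) z = a * quad G z.
Proof. by rewrite !quadE -scalemxAl dotvZr. Qed.

Lemma quadNm n (G : 'M[R]_n) z : quad (- G) z = - quad G z.
Proof. by rewrite !quadE mulNmx dotvNr. Qed.

Lemma quad_gram n m (M : 'M[R]_(m, n)) z :
  quad (M^T *m M) z = dotv (M *m z) (M *m z).
Proof. by rewrite quadE -mulmxA dotv_trmx. Qed.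

Definition quad_lin := (quadDm, quadNm, quadZm, quad_gram).

Lemma quadN n (G : 'M[R]_n) z : quad G (- z) = quad G z.
Proof. by rewrite !quadE mulmxN dotvNl dotvNr opprK. Qed.

Lemma quadZ n (G : 'M[R]_n) a z : quad G (a *: z) = a ^+ 2 * quad G z.
Proof. by rewrite !quadE -scalemxAr dotvZl dotvZr mulrA. Qed.

Lemma symmetricP n (G : 'M[R]_n) : G \is symmetricmx <-> G^T = G.
Proof.
split.
  by move=> /is_hermitianmxP; rewrite expr0 scale1r map_mx_id// => /esym.
by move=> sG; apply/is_hermitianmxP; rewrite expr0 scale1r map_mx_id.
Qed.

Lemma symmetricD n (G H : 'M[R]_n) :
  G \is symmetricmx -> H \is symmetricmx -> G + H \is symmetricmx.
Proof.
move=> /symmetricP sG /symmetricP sH; apply/symmetricP.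
by rewrite linearD/= sG sH.
Qed.

Lemma dotv_sym n (G : 'M[R]_n) u v :
  G \is symmetricmx -> dotv u (G *m v) = dotv v (G *m u).
Proof. by move=> /symmetricP sG; rewrite -{1}sG dotv_trmx dotvC. Qed.

Lemma quadD n (G : 'M[R]_n) u v : G \is symmetricmx ->
  quad G (u + v) = quad G u + 2 * dotv u (G *m v) + quad G v.
Proof.
move=> sG; rewrite !quadE mulmxDr !dotv_lin (dotv_sym v u sG).
by ring.
Qed.

Lemma psd_half n (S Sigma : 'M[R]_n) : S \is symmetricmx -> psd Sigma ->
  psd (S + 2^-1 *: Sigma) -> psd (S + Sigma).
Proof.
move=> sS [sSigma Sigma_ge0] [_ half_ge0]; split; first exact: symmetricD.
move=> z; have := half_ge0 z; have := Sigma_ge0 z.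
by rewrite !quadDm quadZm; lra.
Qed.

Lemma pd_psd n (P : 'M[R]_n) : pd P -> psd P.
Proof.
case=> sP P_gt0; split=> // z; have [->|/P_gt0/ltW//] := eqVneq z 0.
by rewrite quadE mulmx0 /dotv mulmx0 mxE.
Qed.

Lemma pd_unitmx n (P : 'M[R]_n) : pd P -> P \in unitmx.
Proof.
move=> [_ P_gt0]; rewrite -row_free_unit -kermx_eq0; apply/eqP/row_matrixP => i.
rewrite row0; set u := row i _.
have uP0 : u *m P = 0 by apply/sub_kermxP/row_sub.
apply/eqP/negP => /negP u0.
have /P_gt0 : u^T != 0 by rewrite -trmx0 (inj_eq trmx_inj).
by rewrite /quad trmxK uP0 mul0mx mxE ltxx.
Qed.

Lemma pd_cauchy_schwarz n (P : 'M[R]_n) u v : pd P ->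
  dotv u (P *m v) ^+ 2 <= quad P u * quad P v.
Proof.
move=> pdP; have [sP P_gt0] := pdP; have [_ P_ge0] := pd_psd pdP.
have [->|/P_gt0 v_gt0] := eqVneq v 0.
  by rewrite !quadE mulmx0 /dotv !mulmx0 mxE expr0n mulr0.
have := P_ge0 (quad P v *: u + (- dotv u (P *m v)) *: v).
rewrite quadD// !quadZ -scalemxAr !dotv_lin.
set d := dotv _ _; set p := quad P v in v_gt0 *; set q := quad P u => H.
have : 0 <= p * (p * q - d ^+ 2) by lra.
by rewrite pmulr_rge0// subr_ge0 mulrC.
Qed.

(** Each coordinate [z i 0] is the pairing of [P^-1 e_i] with [P z], so
    Cauchy-Schwarz in the inner product of [P] bounds its square by a multiple
    of [quad P z]; every quadratic form is a combination of products of
    coordinates. *)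
Lemma pd_dominates n (P Q : 'M[R]_n) : pd P ->
  exists2 C : R, 0 <= C & forall z, quad Q z <= C * quad P z.
Proof.
move=> pdP; have uP := pd_unitmx pdP; have [_ P_ge0] := pd_psd pdP.
pose e i : 'cV[R]_n := invmx P *m delta_mx i 0.
pose k i := quad P (e i).
have k_ge0 i : 0 <= k i by exact: P_ge0.
have coord i (z : 'cV[R]_n) : z i 0 ^+ 2 <= k i * quad P z.
  have -> : z i 0 = dotv (e i) (P *m z).
    rewrite (dotv_sym _ _ pdP.1) /e mulKVmx// dotvC dotvE.
    rewrite (bigD1 i)//= big1 ?addr0 ?mxE ?eqxx ?mul1r// => j /negPf ji.
    by rewrite mxE ji mul0r.
  exact: pd_cauchy_schwarz.
exists (\sum_i \sum_j `|Q i j| * (k i + k j)).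
  by do 2!(rewrite sumr_ge0// => ? _); rewrite mulr_ge0// addr_ge0.
move=> z; rewrite quadE dotvE mulr_suml; apply: ler_sum => i _.
rewrite mxE mulr_sumr mulr_suml; apply: ler_sum => j _.
rewrite (le_trans (ler_norm _))// mulrCA normrM -mulrA ler_wpM2l//.
have Hi := coord i z; have Hj := coord j z.
have Pz := P_ge0 z; rewrite ler_norml; apply/andP; split; nra.
Qed.

(** * First-order optimality *)

Lemma epigraph_convex n (p : 'cV[R]_n -> \bar R) x z (a b : R) (t : {i01 R}) :
  convex_set (epigraph p) -> (p x <= a%:E)%E -> (p z <= b%:E)%E ->
  (p (t%:num *: x + (1 - t%:num) *: z)%R
    <= (t%:num * a + (1 - t%:num) * b)%:E)%E.
Proof.
move=> cp pa pb.
by have := cp (x, a) (z, b) t; rewrite !inE; apply.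
Qed.

Lemma convex_function_le n (f : 'cV[R]_n -> R) x z (t : {i01 R}) :
  convex_function [set: convex_lmodType 'cV[R]_n] f ->
  f (t%:num *: x + (1 - t%:num) *: z) <= t%:num * f x + (1 - t%:num) * f z.
Proof.
by move=> cf; have := cf t x z; rewrite !inE; apply.
Qed.

(** Along the segment from the minimiser to [z] the convex part grows at most
    linearly and the quadratic part by [t * dotv v (z - x)] up to [O(t^2)];
    divide by [t] and let [t] tend to 0. The quadratic part may be concave. *)
Lemma argmin_first_order n (p : 'cV[R]_n -> \bar R) (f phi : 'cV[R]_n -> R)
    (x v : 'cV[R]_n) (Q : 'cV[R]_n -> R) :
  proper_closed_convex p -> smooth_convex f ->
  (forall d t, phi (x + t *: d) = phi x + t * dotv v d + t ^+ 2 * Q d) ->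
  is_argmin (fun u => (p u + (f u)%:E + (phi u)%:E)%E) x ->
  p x \is a fin_num /\
  subdifferential (fun u => (p u + (f u)%:E)%E) x (- v).
Proof.
move=> [pNy [z0 pz0] _ cp] [cf _] phiE xmin.
have px : p x \is a fin_num.
  rewrite fin_numE pNy/=; apply/eqP => px.
  have := xmin z0; rewrite px !addye// leye_eq.
  by case: (p z0) pz0.
split=> // z.
have [pz|] := boolP (p z \is a fin_num); last first.
  by rewrite fin_numE pNy/= negbK => /eqP ->; rewrite addye// leey.
move: px pz xmin; case Ex : (p x) => [a| |]//.
case Ez : (p z) => [b| |]// _ _ xmin.
rewrite -!EFinD lee_fin dotvNl.
set s := dotv v _.
(* the increment of the objective along [z - x], divided by the step [t] *)
have slope (t : R) : 0 < t -> t <= 1 ->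
    0 <= b + f z - (a + f x) + s + t * Q (z - x).
  move=> t0 t1.
  have t01 : 0 <= 1 - t <= 1 by apply/andP; split; lra.
  pose l : {i01 R} := Itv01 (andP t01).1 (andP t01).2.
  have dE : x + t *: (z - x) = l%:num *: x + (1 - l%:num) *: z.
    by rewrite /= subKr scalerBr scalerBl scale1r addrA addrAC.
  have fl : f (x + t *: (z - x)) <= (1 - t) * f x + t * f z.
    by rewrite dE; have := convex_function_le x z l cf; rewrite /= subKr.
  have pl : (p (x + t *: (z - x))%R <= ((1 - t) * a + t * b)%:E)%E.
    rewrite dE; have := @epigraph_convex _ p x z a b l cp.
    by rewrite Ex Ez /= !lexx subKr => /(_ isT isT).
  have := xmin (x + t *: (z - x)).
  rewrite Ex.
  have : (p (x + t *: (z - x))%R + (f (x + t *: (z - x))%R)%:E +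
      (phi (x + t *: (z - x))%R)%:E <=
      ((1 - t) * a + t * b + ((1 - t) * f x + t * f z)
       + phi (x + t *: (z - x)))%:E)%E.
    by rewrite !EFinD leeD2r// leeD// lee_fin.
  move=> /[swap] /le_trans /[apply]; rewrite -!EFinD lee_fin phiE -/s => H.
  have : 0 <= t * (b + f z - (a + f x) + s + t * Q (z - x)) by lra.
  by rewrite pmulr_rge0.
rewrite -subr_ge0 leNgt; apply/negP => neg.
set D := _ - _ in neg.
have [QD|QD] := lerP (Q (z - x)) 0.
  have := slope 1 ltr01 (lexx _); rewrite /D in neg *; lra.
(* for a negative limit of the slopes, this [t] keeps the correction
   [t * Q (z - x)] below half of its absolute value *)
pose t := Num.min 1 (- D / 2 / Q (z - x)).
have t0 : 0 < t by rewrite lt_min ltr01 !divr_gt0// oppr_gt0.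
have := slope t t0; rewrite ge_min lexx => /(_ isT).
have : t * Q (z - x) <= - D / 2 by rewrite -ler_pdivlMr// ge_min lexx orbT.
rewrite /D in neg *; lra.
Qed.

(** The part of a subproblem of the iteration that is not in [p + f] or [h + g];
    [a] collects the terms of the residual that do not depend on [u]. *)
Definition aug_quadratic n m (M : 'M[R]_(m, n)) (S : 'M[R]_n) (beta : R)
    (l a : 'cV[R]_m) (u0 u : 'cV[R]_n) : R :=
  - dotv l (M *m u + a) + beta / 2 * dotv (M *m u + a) (M *m u + a)
  + 2^-1 * quad S (u - u0).

Lemma aug_quadratic_expand n m (M : 'M[R]_(m, n)) (S : 'M[R]_n) beta l a
    (u0 u d : 'cV[R]_n) t : S \is symmetricmx ->
  aug_quadratic M S beta l a u0 (u + t *: d) =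
  aug_quadratic M S beta l a u0 u
  + t * dotv (- (M^T *m (l - beta *: (M *m u + a)) - S *m (u - u0))) d
  + t ^+ 2 * (beta / 2 * dotv (M *m d) (M *m d) + 2^-1 * quad S d).
Proof.
move=> sS; rewrite /aug_quadratic.
rewrite [M *m (u + _)]mulmxDr -scalemxAr [_ + _ + a]addrAC.
rewrite [u + _ - u0]addrAC; move: (M *m u + a) (u - u0) => r w.
rewrite quadD// quadZ -scalemxAr (dotvC _ d) !dotv_lin dotv_trmx.
move: (M *m d) => e.
rewrite !dotv_lin (dotv_sym d _ sS) (dotvC e r) (dotvC e l).
by field.
Qed.

(** * The matrix [Ghat] along one step *)

Section OneStep.
Context {n1 n2 m : nat}.
Variables (A : 'M[R]_(m, n1)) (B : 'M[R]_(m, n2)).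
Variables (Sigma1 S : 'M[R]_n1) (Sigma2 T : 'M[R]_n2).
Variables (beta alpha gamma : R).
Hypotheses (beta0 : 0 < beta) (ag0 : 0 < alpha + gamma).

Local Notation G := (Ghat B beta alpha gamma S Sigma1 T Sigma2).
Local Notation vec dx dy dl := (col_mx dx (col_mx dy dl)).

(** The increment of the multiplier over one iteration, as a function of [dy]
    and of the new residual [r]: [Ghat] becomes block diagonal in [(dx, dy, r)]. *)
Definition dual_step (dy : 'cV[R]_n2) (r : 'cV[R]_m) : 'cV[R]_m :=
  (alpha * beta) *: (B *m dy) - ((alpha + gamma) * beta) *: r.

Lemma Ghat_sym : S \is symmetricmx -> Sigma1 \is symmetricmx ->
  T \is symmetricmx -> Sigma2 \is symmetricmx -> G \is symmetricmx.
Proof.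
move=> /symmetricP sS /symmetricP s1 /symmetricP sT /symmetricP s2.
apply/symmetricP; rewrite /Ghat !tr_block_mx !trmx0 !linearD/= sS s1 sT s2.
by rewrite !linearZ/= trmx_mul trmxK tr_scalar_mx.
Qed.

Lemma Ghat_mul dx dy r :
  G *m vec dx dy (dual_step dy r) =
  vec ((S + Sigma1) *m dx)
      ((T + Sigma2) *m dy + B^T *m (((1 - alpha) * beta) *: (B *m dy)
                                    + (alpha * beta) *: r))
      (- r).
Proof.
have ag_neq0 : alpha + gamma != 0 by rewrite gt_eqF.
have beta_neq0 : beta != 0 by rewrite gt_eqF.
rewrite /Ghat !mul_block_col !mul0mx addr0 add0r /dual_step.
congr (col_mx _ (col_mx _ _)).
  rewrite mulmxDl -!scalemxAl -addrA; congr (_ + _).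
  rewrite -mulmxA !mulmxDr !mulmxN -!scalemxAr.
  rewrite scalerDr scalerN !scalerA addrA -scalerDl -[- (_ *: (_ *m r))]scaleNr.
  by congr (_ *: _ + _ *: _); field.
rewrite -scalemxAl mul_scalar_mx scalerDr scalerN !scalerA addrA -scalerDl.
rewrite -[- (_ *: r)]scaleNr [X in X *: _ + _](_ : _ = 0) ?scale0r ?add0r.
  by rewrite -[RHS]scaleN1r; congr (_ *: _); field; rewrite ag_neq0 beta_neq0.
by field; rewrite ag_neq0 beta_neq0.
Qed.

Lemma Ghat_pair ex ey l dx dy r :
  dotv (vec ex ey l) (G *m vec dx dy (dual_step dy r)) =
  dotv ex ((S + Sigma1) *m dx) + dotv ey ((T + Sigma2) *m dy)
  + (1 - alpha) * beta * dotv (B *m ey) (B *m dy)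
  + alpha * beta * dotv (B *m ey) r - dotv l r.
Proof.
by rewrite Ghat_mul !dotv_col (dotvDr ey) dotv_trmx !dotv_lin !addrA.
Qed.

Lemma Ghat_quad dx dy r :
  quad G (vec dx dy (dual_step dy r)) =
  quad (S + Sigma1) dx + quad (T + Sigma2) dy
  + (1 - alpha) * beta * dotv (B *m dy) (B *m dy)
  + (alpha + gamma) * beta * dotv r r.
Proof.
rewrite quadE Ghat_pair /dual_step !dotv_lin -!quadE.
by ring.
Qed.

Lemma dual_stepP dy (l : 'cV[R]_m) : exists r, l = dual_step dy r.
Proof.
exists (((alpha + gamma) * beta)^-1 *: ((alpha * beta) *: (B *m dy) - l)).
rewrite /dual_step scalerA divff ?scale1r ?subKr//.
by rewrite gt_eqF// mulr_gt0.
Qed.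

(** Every vector has the form of [Ghat_quad], whose terms in [dy] add up to
    the second hypothesis, a Schur complement of [Ghat]. *)
Lemma Ghat_ge0 w : psd (S + Sigma1) ->
  psd (T + Sigma2 + ((1 - alpha) * beta) *: (B^T *m B)) -> 0 <= quad G w.
Proof.
move=> [_ S0] [_ T0].
rewrite -[w]vsubmxK -[dsubmx w]vsubmxK.
have [r ->] := dual_stepP (usubmx (dsubmx w)) (dsubmx (dsubmx w)).
rewrite Ghat_quad addr_ge0//; last first.
  by rewrite mulr_ge0 ?dotv_ge0// mulr_ge0// ltW.
rewrite -addrA addr_ge0//.
by have := T0 (usubmx (dsubmx w)); rewrite quadDm quadZm quad_gram.
Qed.

(** The point [(ex, ey, l + dual_step dy r)] is the new error with respect to a
    saddle point. After [A ex] is eliminated, the sum of the two pairings is, up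
    to terms in [r] and [B *m dy] only, minus the pairing of the new error with
    [Ghat] (less [Sigma1] and [Sigma2]) times the increment. The weights [2^-1]
    come from [2 a^2 - 2 <a, d> + d^2 = d^2 / 2 + (2 a - d)^2 / 2] in the
    seminorms of [Sigma1] and [Sigma2]. *)
Lemma Ghat_descent ex dx ey dy (l r : 'cV[R]_m) :
  S \is symmetricmx -> psd Sigma1 -> T \is symmetricmx -> psd Sigma2 ->
  r = A *m ex + B *m ey ->
  quad Sigma1 ex <=
    dotv ex (A^T *m (l - beta *: (r - B *m dy)) - S *m dx) ->
  quad Sigma2 ey <=
    dotv ey (B^T *m (l - (alpha * beta) *: (r - B *m dy) - beta *: r)
             - T *m dy) ->
  quad (S + 2^-1 *: Sigma1) dx + quad (T + 2^-1 *: Sigma2) dy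
  + beta * ((1 - alpha) * dotv (B *m dy) (B *m dy)
            + (2 - alpha - gamma) * dotv r r
            - 2 * (1 - alpha) * dotv (B *m dy) r)
  <= quad G (vec (ex - dx) (ey - dy) l)
     - quad G (vec ex ey (l + dual_step dy r)).
Proof.
move=> sS [s1 S1] sT [s2 S2] rE Hx Hy.
set w := vec ex ey _; set dw := vec dx dy (dual_step dy r).
have -> : vec (ex - dx) (ey - dy) l = w + - dw.
  by rewrite /w /dw !opp_col_mx !add_col_mx addrK.
rewrite quadD; last exact: Ghat_sym.
rewrite quadN mulmxN dotvNr Ghat_pair Ghat_quad.
have X1 := S1 (ex + ex - dx); have X2 := S2 (ey + ey - dy).
rewrite (quadD _ _ s1) quadN (quadD _ _ s1) mulmxN in X1.
rewrite (quadD _ _ s2) quadN (quadD _ _ s2) mulmxN in X2.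
have Ae : A *m ex = r - B *m ey by rewrite rE addrK.
rewrite dotvDr dotv_trmx Ae dotvNr in Hx.
rewrite dotvDr dotv_trmx dotvNr in Hy.
rewrite /dual_step !quad_lin !mulmxDl !dotv_lin.
rewrite !dotv_lin -?quadE in X1 X2 Hx Hy.
rewrite (dotvC r (B *m dy)) (dotvC l) in Hx Hy *.
lra.
Qed.

End OneStep.

(** * Dissipation on the stepsize domain *)

(** Optimality of two consecutive [y]-iterates, paired with their difference.
    The indefinite term [dotv dy (T *m dy')] linking consecutive steps is split
    along [T = Tp - Tm]; both parts are bounded by Cauchy's inequality, which
    leaves a telescoping difference and the loss [- 2 * quad Tm dy]. *)
Lemma cross_term_bound n m (B : 'M[R]_(m, n)) (Sigma Tp Tm : 'M[R]_n)
    beta alpha gamma (dy dy' : 'cV[R]_n) (r r' : 'cV[R]_m) :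
  psd Tp -> psd Tm ->
  quad Sigma dy <=
    dotv dy (B^T *m ((beta * (1 - gamma)) *: r'
                     + (alpha * beta) *: (B *m dy)
                     - ((1 + alpha) * beta) *: r)
             - (Tp - Tm) *m (dy - dy')) ->
  quad (- (2 *: Tm) + Sigma) dy
  + 2^-1 * (quad (Tp + Tm) dy - quad (Tp + Tm) dy')
  + beta * ((gamma - 1) * dotv (B *m dy) r'
            - alpha * dotv (B *m dy) (B *m dy))
  <= - ((1 + alpha) * beta) * dotv (B *m dy) r.
Proof.
move=> [sp Tp0] [sm Tm0]; rewrite dotvDr dotv_trmx !quad_lin => H.
have P := Tp0 (dy - dy'); have M := Tm0 (dy + dy').
rewrite quadD// quadN mulmxN in P; rewrite quadD// in M.
rewrite mulmxDl mulNmx !mulmxDr !mulmxN !dotv_lin -!quadE in H.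
rewrite !dotv_lin in P.
lra.
Qed.

(** [gamma_bound alpha] is the larger root of the quadratic in [gamma]. *)
Lemma gamma_bound_lt (alpha gamma : R) :
  0 <= alpha < 1 -> 0 <= gamma < gamma_bound alpha ->
  gamma ^+ 2 < 1 - alpha ^+ 2 + alpha - (alpha - 1) * gamma.
Proof.
move=> /andP[a0 a1] /andP[g0]; rewrite /gamma_bound.
set d := (1 + alpha) ^+ 2 + _.
have d0 : 0 <= d.
  have : 0 <= (1 - alpha) * (1 + alpha) by rewrite mulr_ge0//; lra.
  by have := sqr_ge0 (1 + alpha); rewrite /d; lra.
have s0 := sqrtr_ge0 d; have := sqr_sqrtr d0; rewrite [in X in _ = X]/d.
move: (Num.sqrt d) s0 => s s0 sE gs.
have [h|h] := lerP (2 * gamma) (1 - alpha); first nra.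
have : (2 * gamma - 1 + alpha) ^+ 2 < s ^+ 2.
  by rewrite ltr_pXn2r// ?nnegrE; lra.
lra.
Qed.

(** The square that survives in [dissipation] is that of
    [r - residual_weight *: (B *m dy)]. *)
Definition residual_weight (alpha gamma : R) : R :=
  if inD1 alpha gamma then 0
  else if inD2 alpha gamma then 2^-1
  else (1 - alpha) / (2 - alpha - gamma).

(** With [u = B *m dy], [r] the new and [r'] the old residual, the form on the
    right is [(2 - alpha - gamma) |r - mu u|^2] plus a nonnegative multiple of
    [|u|^2] when [gamma < 1]. For [gamma = 1] half of the cross term, and for
    [gamma > 1] all of it, is first replaced through the hypothesis on [N], where
    [beta * N] stands for the [quad] terms of [cross_term_bound]. For [gamma > 1]
    a product [dotv u r'] appears; Cauchy's inequality bounds it by the fraction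
    [1 - cag] of [|u|^2] left by [kappa2] plus [sigma |r'|^2], and the upper
    bound on [cag] says precisely that [sigma < 2 - alpha - gamma]. *)
Lemma dissipation (alpha gamma cag : R) :
  inD alpha gamma -> c_range alpha gamma cag ->
  exists eps sigma : R, [/\ 0 < eps, 0 <= sigma, 0 <= kappa1 alpha gamma &
    forall m (u r r' : 'cV[R]_m) (N : R),
    N + (gamma - 1) * dotv u r' - alpha * dotv u u
      <= - (1 + alpha) * dotv u r ->
    let v := r - residual_weight alpha gamma *: u in
    kappa1 alpha gamma * N + kappa2 alpha gamma cag * dotv u u
    + sigma * (dotv r r - dotv r' r') + eps * dotv v v
    <= (1 - alpha) * dotv u u + (2 - alpha - gamma) * dotv r r
       - 2 * (1 - alpha) * dotv u r].
Proof.
move=> /and3P[/andP[a0 a1] /andP[g0 gb] ag] [c1 c23].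
have gbnd :=
  gamma_bound_lt (introT andP (conj a0 a1)) (introT andP (conj g0 gb)).
rewrite /kappa1 /kappa2 /residual_weight.
have a1p : 0 < 1 + alpha by lra.
case: ifPn => [D1|nD1].
  have g1 : 1 < gamma by case/and3P: D1.
  have g2 := sqr_ge0 (gamma - 1).
  have K0 : 0 < (2 - alpha - gamma) * (1 + alpha) by lra.
  have ag2 : 0 < 2 - alpha - gamma by rewrite -(pmulr_lgt0 _ a1p).
  have /andP[c0] := c1 D1; rewrite ltr_pdivlMr ?mulr_gt0// => cN.
  have cl1 : cag < 1 by rewrite -(ltr_pM2r K0); lra.
  pose sigma := (gamma - 1) ^+ 2 / ((1 + alpha) * (1 - cag)).
  have sigma0 : 0 <= sigma.
    by rewrite divr_ge0 ?sqr_ge0// ltW// mulr_gt0// subr_gt0.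
  exists (2 - alpha - gamma - sigma), sigma; split=> //.
  - rewrite subr_gt0 ltr_pdivrMr ?mulr_gt0 ?subr_gt0//; lra.
  - by rewrite divr_ge0 ?mulr_ge0 ?subr_ge0// ltW.
  move=> m u r r' N H; rewrite scale0r subr0.
  set k1 := 2 * (1 - alpha) / (1 + alpha).
  (* the square of [(1 - cag) (1 - alpha) u + (gamma - 1) r'], rescaled *)
  have Hq : 0 <= (1 - cag) * (1 - alpha) ^+ 2 / (1 + alpha) * dotv u u
              + k1 * (gamma - 1) * dotv u r' + sigma * dotv r' r'.
    rewrite [leRHS](_ : _ =
        dotv (((1 - cag) * (1 - alpha)) *: u + (gamma - 1) *: r')
             (((1 - cag) * (1 - alpha)) *: u + (gamma - 1) *: r')
        / ((1 + alpha) * (1 - cag))).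
      by rewrite divr_ge0 ?dotv_ge0// ltW// mulr_gt0// subr_gt0.
    rewrite !dotv_lin (dotvC r' u) /k1 /sigma.
    by field; rewrite !gt_eqF ?subr_gt0.
  have Hk : k1 * (N + (gamma - 1) * dotv u r' - alpha * dotv u u)
      <= - (2 * (1 - alpha)) * dotv u r.
    rewrite [leRHS](_ : _ = k1 * (- (1 + alpha) * dotv u r)).
      by rewrite ler_wpM2l// divr_ge0 ?mulr_ge0 ?subr_ge0// ltW.
    by rewrite /k1; field; rewrite gt_eqF.
  have HU : k1 * alpha * dotv u u
      + cag * (1 - alpha) ^+ 2 / (1 + alpha) * dotv u u
      + (1 - cag) * (1 - alpha) ^+ 2 / (1 + alpha) * dotv u u
      = (1 - alpha) * dotv u u.
    by rewrite /k1; field; rewrite gt_eqF.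
  lra.
case: ifPn => [/andP[_ /eqP g1]|nD2].
  have /andP[c0 cl1] : 0 < cag < 1 by apply: c23; rewrite /inD2 a0 a1 g1 eqxx.
  subst gamma.
  exists (1 - alpha), 0; split=> //.
  - by rewrite subr_gt0.
  - by rewrite divr_ge0 ?subr_ge0// ltW.
  move=> m u r r' N; rewrite subrr mul0r addr0 => H.
  set k1 := (1 - alpha) / (1 + alpha).
  have Hk : k1 * (N - alpha * dotv u u) <= - (1 - alpha) * dotv u r.
    rewrite [leRHS](_ : _ = k1 * (- (1 + alpha) * dotv u r)).
      by rewrite ler_wpM2l// divr_ge0 ?subr_ge0// ltW.
    by rewrite /k1; field; rewrite gt_eqF.
  pose K := (1 - alpha) * (3 - alpha) / (4 * (1 + alpha)) * dotv u u.
  have K0 : 0 <= K.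
    by rewrite mulr_ge0 ?dotv_ge0// divr_ge0 ?mulr_ge0//; lra.
  have cK : cag * K <= K by rewrite ler_piMl// ltW.
  have HU : k1 * alpha * dotv u u + K = (1 - alpha) * (3 / 4) * dotv u u.
    by rewrite /k1 /K; field; rewrite gt_eqF.
  have KE : cag * (1 - alpha) * (3 - alpha) / (4 * (1 + alpha)) * dotv u u
      = cag * K by rewrite /K !mulrA.
  rewrite KE !dotv_lin (dotvC r u).
  lra.
have gl1 : gamma < 1.
  rewrite ltNge le_eqVlt; apply/negP => /orP[/eqP g1|g1].
    by move: nD2; rewrite /inD2 a0 a1 -g1 eqxx.
  by move: nD1; rewrite /inD1 a0 a1 g1 gb.
have e0 : 0 < 2 - alpha - gamma by lra.
exists (2 - alpha - gamma), 0; split=> //.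
move=> m u r r' N _.
set k2 := (if _ then _ else _).
have k2le : k2 * dotv u u
    <= (1 - alpha) * (1 - gamma) / (2 - alpha - gamma) * dotv u u.
  rewrite ler_wpM2r ?dotv_ge0// /k2; case: ifPn => [D3|nD3].
    have /andP[c0 cl1] : 0 < cag < 1 by apply: c23; rewrite D3 orbT.
    rewrite [2 - gamma - alpha]addrAC -!mulrA ler_piMl ?(ltW cl1)//.
    by rewrite !mulr_ge0 ?invr_ge0//; lra.
  have -> : gamma = alpha.
    by apply/eqP; move: nD3; rewrite /inD3 a0 a1 g0 gl1 ag/= negbK eq_sym.
  rewrite [leRHS](_ : _ = (1 - alpha) / 2)//; field.
  by rewrite gt_eqF//; lra.
have HU : (1 - alpha) * (1 - gamma) / (2 - alpha - gamma) * dotv u u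
    + (1 - alpha) ^+ 2 / (2 - alpha - gamma) * dotv u u
    = (1 - alpha) * dotv u u.
  by field; rewrite gt_eqF.
rewrite !dotv_lin (dotvC r u) -/k2.
set mu := (1 - alpha) / _.
have HX : (2 - alpha - gamma) * (mu * dotv u r) = (1 - alpha) * dotv u r.
  by rewrite /mu; field; rewrite gt_eqF.
have HM : (2 - alpha - gamma) * (mu * (mu * dotv u u))
    = (1 - alpha) ^+ 2 / (2 - alpha - gamma) * dotv u u.
  by rewrite /mu; field; rewrite gt_eqF.
lra.
Qed.

(** * Running minima of summable sequences *)

(** A convergent nonnegative series has [o(1/t)] running minima: the terms with
    index in the second half of [1..t] number at least [t/2] and sum to a tail
    of the series. Convergence is expressed by a potential [V] whose decrease
    dominates the terms. *)
Lemma running_min_littleo (a V : nat -> R) :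
  (forall k, 0 <= a k) -> (forall k, 0 <= V k) ->
  (forall k, (0 < k)%N -> a k <= V k - V k.+1) ->
  (running_min a : nat -> R^o) =o_\oo (fun t => t%:R^-1 : R^o).
Proof.
move=> a0 V0 aV; apply/eqoP => e e0.
pose E := [set V k | k in [set k | (0 < k)%N]].
have infE : has_inf E.
  by split; [exists (V 1%N), 1%N|exists 0 => _ [k _ <-]].
have e20 : 0 < e / 2 by rewrite divr_gt0.
have [_ [N N0 <-] VN] := inf_adherent e20 infE.
have Vinf k : (0 < k)%N -> inf E <= V k.
  by move=> k0; apply: (ge_inf infE.2); exists k.
exists (N + N)%N => // t /= Nt.
have Nt1 : (N <= t)%N by apply: leq_trans Nt; rewrite leq_addr.
set mu := running_min a t.
have mu0 : 0 <= mu by apply: le_bigmin.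
have mu_le i : (0 < i <= t)%N -> mu <= a i.
  move=> it; rewrite /mu /running_min.
  by apply: (@ge_bigmin_seq _ _ _ _ _ i); rewrite ?mem_index_iota.
have sum_le j : (N + j <= t.+1)%N -> mu * j%:R <= V N - V (N + j)%N.
  elim: j => [|j IHj] jt; first by rewrite mulr0 addn0 subrr.
  rewrite addnS in jt *.
  have Nj0 : (0 < N + j)%N by rewrite addn_gt0 N0.
  have := IHj (ltnW jt); have := aV _ Nj0.
  have := mu_le (N + j)%N; rewrite Nj0/= => /(_ jt).
  rewrite -natr1; lra.
have t0 : (0 < t)%N by apply: leq_trans N0 Nt1.
have tR0 : 0 < t%:R :> R by rewrite ltr0n.
rewrite !ger0_norm ?invr_ge0 ?ler0n// ler_pdivlMr//.
have := sum_le (t - N)%N; rewrite subnKC// => /(_ (leqnSn t)).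
have := Vinf t t0.
have : t%:R <= 2 * (t - N)%:R :> R.
  by rewrite -natrM ler_nat mul2n -addnn; lia.
move=> h1 h2 h3; have := ler_wpM2l mu0 h1; lra.
Qed.

(** * The iteration *)

Section Iteration.
Context {n1 n2 m : nat}.
Variables (A : 'M[R]_(m, n1)) (B : 'M[R]_(m, n2)) (b : 'cV[R]_m).
Variables (p : 'cV[R]_n1 -> \bar R) (f : 'cV[R]_n1 -> R).
Variables (h : 'cV[R]_n2 -> \bar R) (g : 'cV[R]_n2 -> R).
Let theta1 := fun x => (p x + (f x)%:E)%E.
Let theta2 := fun y => (h y + (g y)%:E)%E.
Variables (Sigma1 S : 'M[R]_n1) (Sigma2 T Tp Tm : 'M[R]_n2).
Variables (beta alpha gamma cag c : R).
Variables (x : nat -> 'cV[R]_n1) (y : nat -> 'cV[R]_n2) (lam : nat -> 'cV[R]_m).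
Hypotheses (pP : proper_closed_convex p) (fP : smooth_convex f).
Hypotheses (hP : proper_closed_convex h) (gP : smooth_convex g).
Hypotheses (sS : S \is symmetricmx) (sT : T \is symmetricmx).
Hypothesis iter : iPSPR theta1 theta2 A B b beta alpha gamma S T x y lam.

Let r k : 'cV[R]_m := A *m x k + B *m y k - b.
Let dx k : 'cV[R]_n1 := x k.+1 - x k.
Let dy k : 'cV[R]_n2 := y k.+1 - y k.

Lemma half_residual k : A *m x k.+1 + B *m y k - b = r k.+1 - B *m dy k.
Proof.
rewrite /r /dy mulmxBr; move: (A *m _) (B *m y k) (B *m y k.+1) => u v w.
by apply/matrixP => i j; rewrite !mxE; ring.
Qed.

Lemma x_subgradient k : p (x k.+1) \is a fin_num /\
  subdifferential theta1 (x k.+1)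
    (A^T *m (lam k - beta *: (r k.+1 - B *m dy k)) - S *m dx k).
Proof.
have [+ _ _] := iter k; set F := (fun u => _) => xmin.
have := argmin_first_order pP fP (fun d t =>
  aug_quadratic_expand A beta (lam k) (B *m y k - b) (x k) (x k.+1) d t sS).
rewrite opprK addrA half_residual; apply.
move=> z; have := xmin z; rewrite /F /aug_lagrangian /aug_quadratic /theta1.
by rewrite !sqr_enorm !adde0 !addrA !EFinD !EFinN -!addeA.
Qed.

Lemma y_subgradient k :
  subdifferential theta2 (y k.+1)
    (B^T *m (lam k - (alpha * beta) *: (r k.+1 - B *m dy k) - beta *: r k.+1)
     - T *m dy k).
Proof.
have [_ + _] := iter k; set F := (fun v => _) => ymin.
set lamh := lam k - _.
have := argmin_first_order hP gP (fun d t =>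
  aug_quadratic_expand B beta lamh (A *m x k.+1 - b) (y k) (y k.+1) d t sT).
rewrite opprK addrA [B *m _ + _]addrC; case=> //.
move=> z; have := ymin z; rewrite /F /aug_lagrangian /aug_quadratic /theta2.
have [px _] := x_subgradient k.
rewrite half_residual -/lamh.
have E v : (A *m x k.+1 + B *m v - b) = B *m v + (A *m x k.+1 - b).
  by rewrite addrA [B *m _ + _]addrC.
by rewrite !E !sqr_enorm !EFinD !EFinN -!addeA leeD2lE// leeD2lE.
Qed.

Lemma dual_update k :
  lam k.+1 = lam k + dual_step B beta alpha gamma (dy k) (r k.+1).
Proof.
have [_ _ ->] := iter k; rewrite half_residual -/(r k.+1) /dual_step.
move: (lam k) (r k.+1) (B *m dy k) => l u v.
by apply/matrixP => i j; rewrite !mxE; ring.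
Qed.

Hypotheses (C1 : convexity_matrix theta1 Sigma1).
Hypotheses (C2 : convexity_matrix theta2 Sigma2).
Hypotheses (TE : T = Tp - Tm) (Tp0 : psd Tp) (Tm0 : psd Tm).
Hypotheses (beta0 : 0 < beta) (D : inD alpha gamma).
Hypotheses (cR : c_range alpha gamma cag).

Local Notation G := (Ghat B beta alpha gamma S Sigma1 T Sigma2).
Local Notation P := (T + 2^-1 *: Sigma2
  + kappa1 alpha gamma *: (- (2 *: Tm) + Sigma2)
  + (kappa2 alpha gamma cag * beta) *: (B^T *m B)).
Let w k : 'cV[R]_(n1 + (n2 + m)) := col_mx (x k) (col_mx (y k) (lam k)).

Let sum0 : 0 < alpha + gamma.
Proof. by have /and3P[] := D. Qed.

Lemma increment k : w k.+1 - w k =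
  col_mx (dx k) (col_mx (dy k) (dual_step B beta alpha gamma (dy k) (r k.+1))).
Proof.
by rewrite /w !opp_col_mx !add_col_mx dual_update [lam k + _]addrC addrK.
Qed.

Lemma saddle_descent xs ys ls k :
  kkt_set theta1 theta2 A B b (xs, ys, ls) ->
  quad (S + 2^-1 *: Sigma1) (dx k) + quad (T + 2^-1 *: Sigma2) (dy k)
  + beta * ((1 - alpha) * dotv (B *m dy k) (B *m dy k)
            + (2 - alpha - gamma) * dotv (r k.+1) (r k.+1)
            - 2 * (1 - alpha) * dotv (B *m dy k) (r k.+1))
  <= quad G (w k - col_mx xs (col_mx ys ls))
     - quad G (w k.+1 - col_mx xs (col_mx ys ls)).
Proof.
case=> /= feas optx opty.
have := @Ghat_descent _ _ _ A B Sigma1 S Sigma2 T beta alpha gamma beta0 sum0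
  (x k.+1 - xs) (dx k) (y k.+1 - ys) (dy k) (lam k - ls) (r k.+1)
  sS C1.1 sT C2.1.
rewrite /w !opp_col_mx !add_col_mx dual_update.
rewrite [lam k + dual_step _ _ _ _ _ _ - ls]addrAC.
have -> : x k.+1 - xs - dx k = x k - xs.
  by apply/matrixP => i j; rewrite !mxE; ring.
have -> : y k.+1 - ys - dy k = y k - ys.
  by apply/matrixP => i j; rewrite !mxE; ring.
apply.
- rewrite /r -feas !mulmxBr.
  move: (A *m _) (A *m xs) (B *m _) (B *m ys) => a1 a2 b1 b2.
  by apply/matrixP => i j; rewrite !mxE; ring.
- have [_ xsub] := x_subgradient k; apply: le_trans (C1.2 _ _ _ _ xsub optx) _.
  rewrite le_eqVlt; apply/orP; left; apply/eqP; congr (dotv _ _).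
  rewrite !mulmxBr.
  move: (A^T *m _) (A^T *m _) (A^T *m ls) (S *m _) => a1 a2 a3 a4.
  by apply/matrixP => i j; rewrite !mxE; ring.
- have ysub := y_subgradient k; apply: le_trans (C2.2 _ _ _ _ ysub opty) _.
  rewrite le_eqVlt; apply/orP; left; apply/eqP; congr (dotv _ _).
  rewrite !mulmxBr; move: (B^T *m lam k) (B^T *m ls) (T *m _) => a1 a2 a3.
  move: (B^T *m (alpha * beta *: _)) (B^T *m (beta *: _)) => a4 a5.
  by apply/matrixP => i j; rewrite !mxE; ring.
Qed.

Lemma successive_descent k :
  quad (- (2 *: Tm) + Sigma2) (dy k.+1)
  + 2^-1 * (quad (Tp + Tm) (dy k.+1) - quad (Tp + Tm) (dy k))
  + beta * ((gamma - 1) * dotv (B *m dy k.+1) (r k.+1)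
            - alpha * dotv (B *m dy k.+1) (B *m dy k.+1))
  <= - ((1 + alpha) * beta) * dotv (B *m dy k.+1) (r k.+2).
Proof.
apply: cross_term_bound => //.
apply: le_trans (C2.2 _ _ _ _ (y_subgradient k.+1) (y_subgradient k)) _.
rewrite le_eqVlt; apply/orP; left; apply/eqP; congr (dotv _ _).
rewrite dual_update /dual_step -TE [T *m (dy k.+1 - dy k)]mulmxBr.
move: (T *m dy k.+1) (T *m dy k) (B *m dy k.+1) (B *m dy k) => t1 t0 u1 u0.
move: (r k.+2) (r k.+1) (lam k) => r2 r1 l.
rewrite [in RHS](_ : _ - ((1 + alpha) * beta) *: r2 =
  l + (alpha * beta *: u0 - (alpha + gamma) * beta *: r1)
    - alpha * beta *: (r2 - u1) - beta *: r2
  - (l - alpha * beta *: (r1 - u0) - beta *: r1)); last first.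
  by apply/matrixP => i j; rewrite !mxE; ring.
rewrite [in RHS]mulmxBr; move: (B^T *m _) (B^T *m _) => a1 a2.
by apply/matrixP => i j; rewrite !mxE; ring.
Qed.

(** Step [0] is excluded because [successive_descent] pairs the subgradients at
    both ends of a step, and the starting point need not have one. *)
Lemma iPSPR_potential :
  kkt_set theta1 theta2 A B b !=set0 ->
  psd (S + 2^-1 *: Sigma1) ->
  psd (T + Sigma2 + ((1 - alpha) * beta) *: (B^T *m B)) -> pd P ->
  0 < c -> psd (S + 2^-1 *: Sigma1 - (2^-1 * c) *: Sigma1) ->
  exists V : nat -> R, (forall k, 0 <= V k) /\
    forall k, (0 < k)%N -> quad G (w k - w k.+1) <= V k - V k.+1.
Proof.
move=> [[[xs ys] ls] kkt] S0 T0 pdP c0 [_ Sc0].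
have [eps [sigma [eps0 sigma0 k10 diss]]] := dissipation D cR.
set mu := residual_weight alpha gamma in diss.
(* the part of [quad Ghat] in [dy], including the share of [|r|^2] that
   [|r|^2 <= 2 |r - mu B dy|^2 + 2 mu^2 |B dy|^2] moves to [dy] *)
pose Q := T + Sigma2
  + ((1 - alpha) * beta + 2 * mu ^+ 2 * ((alpha + gamma) * beta)) *: (B^T *m B).
have [CQ CQ0 QP] := pd_dominates Q pdP.
have [_ P0] := pd_psd pdP.
pose E k := quad G (w k - col_mx xs (col_mx ys ls))
  + kappa1 alpha gamma / 2 * quad (Tp + Tm) (dy k.-1)
  + beta * sigma * dotv (r k) (r k).
pose v k := r k.+1 - mu *: (B *m dy k).
(* [N] carries half of the difference of [quad (Tp + Tm)] between consecutive
   steps, and [sigma] the difference of the squared residuals *)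
have Estep k : quad (S + 2^-1 *: Sigma1) (dx k.+1) + quad P (dy k.+1)
    + beta * (eps * dotv (v k.+1) (v k.+1)) <= E k.+1 - E k.+2.
  have H1 := saddle_descent k.+1 kkt; have H2 := successive_descent k.
  have [N NE] : exists N, beta * N = quad (- (2 *: Tm) + Sigma2) (dy k.+1)
      + 2^-1 * (quad (Tp + Tm) (dy k.+1) - quad (Tp + Tm) (dy k)).
    by eexists; exact: (mulVKf (lt0r_neq0 beta0)).
  have H3 : N + (gamma - 1) * dotv (B *m dy k.+1) (r k.+1)
      - alpha * dotv (B *m dy k.+1) (B *m dy k.+1)
      <= - (1 + alpha) * dotv (B *m dy k.+1) (r k.+2).
    rewrite -(ler_pM2l beta0); move: H2; rewrite -NE; lra.
  have /(ler_wpM2l (ltW beta0)) H4 := diss _ _ _ _ _ H3.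
  rewrite -/(v k.+1) in H4.
  have NE' := congr1 ( *%R (kappa1 alpha gamma)) NE.
  rewrite /E /=.
  rewrite !quad_lin in H1 NE' *.
  lra.
(* one constant for the three terms of [Estep]: [1 + c^-1] for [dx], [CQ] for
   [dy], the last summand for [r - mu B dy] *)
pose C := 1 + c^-1 + CQ + 2 * (alpha + gamma) / eps.
have C0 : 0 <= C.
  by rewrite !addr_ge0 ?invr_ge0 ?mulr_ge0 ?invr_ge0// ltW.
exists (fun k => C * E k); split=> [k|[//|k] _].
  rewrite mulr_ge0// !addr_ge0//.
  - by apply: Ghat_ge0 => //; exact: psd_half C1.1 S0.
  - by rewrite mulr_ge0 ?divr_ge0// quad_lin addr_ge0 ?(Tp0.2, Tm0.2).
  - by rewrite mulr_ge0 ?dotv_ge0// mulr_ge0// ltW.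
rewrite -opprB quadN increment Ghat_quad// -mulrBr.
apply: le_trans (ler_wpM2l C0 (Estep k)).
set dX := dx k.+1; set dY := dy k.+1; set V := v k.+1.
have X1 : quad (S + Sigma1) dX <= (1 + c^-1) * quad (S + 2^-1 *: Sigma1) dX.
  have := Sc0 dX; rewrite quadDm quadNm quadZm => H.
  have : quad Sigma1 dX <= 2 * (c^-1 * quad (S + 2^-1 *: Sigma1) dX).
    rewrite mulrCA ler_pdivlMl//; lra.
  rewrite !quad_lin; lra.
have X2 : dotv (r k.+2) (r k.+2)
    <= 2 * dotv V V + 2 * mu ^+ 2 * dotv (B *m dY) (B *m dY).
  have := dotv_ge0 (V - mu *: (B *m dY)).
  have -> : r k.+2 = V + mu *: (B *m dY) by rewrite /V /v subrK.
  rewrite !dotv_lin; lra.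
have X3 := QP dY.
have X4 : (alpha + gamma) * beta * dotv (r k.+2) (r k.+2)
    <= (alpha + gamma) * beta
       * (2 * dotv V V + 2 * mu ^+ 2 * dotv (B *m dY) (B *m dY)).
  by rewrite ler_wpM2l// ltW// mulr_gt0.
have X5 : 2 * (alpha + gamma) / eps * (beta * (eps * dotv V V))
   = (alpha + gamma) * beta * (2 * dotv V V).
  by field; rewrite gt_eqF.
set a := quad (S + 2^-1 *: Sigma1) dX in X1 *.
set q := quad P dY in X3 *.
set e := beta * (eps * dotv V V) in X5 *.
have a0 : 0 <= a by exact: S0.2.
have q0 : 0 <= q by exact: P0.
have e0 : 0 <= e by rewrite /e !mulr_ge0 ?dotv_ge0// ltW.
have ci0 : 0 <= c^-1 by rewrite invr_ge0 ltW.
have ae0 : 0 <= 2 * (alpha + gamma) / eps by rewrite divr_ge0 ?mulr_ge0// ltW.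
have Y1 := mulr_ge0 ci0 q0; have Y2 := mulr_ge0 ci0 e0.
have Y3 := mulr_ge0 CQ0 a0; have Y4 := mulr_ge0 CQ0 e0.
have Y5 := mulr_ge0 ae0 a0; have Y6 := mulr_ge0 ae0 q0.
rewrite /Q quadDm quadZm quad_gram in X3.
rewrite /C.
move: X1 X3 X4 X5 Y5 Y6; set K := _ / eps; move=> *.
lra.
Qed.

End Iteration.

End Splitting.

Theorem theorem4p1 (R : realType) (n1 n2 m : nat)
    (A : 'M[R]_(m, n1)) (B : 'M[R]_(m, n2)) (b : 'cV[R]_m)
    (p : 'cV[R]_n1 -> \bar R) (f : 'cV[R]_n1 -> R)
    (h : 'cV[R]_n2 -> \bar R) (g : 'cV[R]_n2 -> R)
    (theta1 := fun x => (p x + (f x)%:E)%E)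
    (theta2 := fun y => (h y + (g y)%:E)%E)
    (Sigma1 S : 'M[R]_n1) (Sigma2 T Tp Tm : 'M[R]_n2)
    (beta alpha gamma cag c : R)
    (x : nat -> 'cV[R]_n1) (y : nat -> 'cV[R]_n2) (lam : nat -> 'cV[R]_m)
    (w := fun k => col_mx (x k) (col_mx (y k) (lam k))) :
  proper_closed_convex p -> smooth_convex f ->
  proper_closed_convex h -> smooth_convex g ->
  kkt_set theta1 theta2 A B b !=set0 ->
  convexity_matrix theta1 Sigma1 -> convexity_matrix theta2 Sigma2 ->
  S \is symmetricmx -> T \is symmetricmx ->
  T = Tp - Tm -> psd Tp -> psd Tm ->
  0 < beta -> inD alpha gamma -> c_range alpha gamma cag ->
  iPSPR theta1 theta2 A B b beta alpha gamma S T x y lam ->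
  psd (S + 2^-1 *: Sigma1) ->
  pd (S + 2^-1 *: Sigma1 + beta *: (A^T *m A)) ->
  pd (T + Sigma2 + ((1 - alpha) * beta) *: (B^T *m B)) ->
  pd (T + 2^-1 *: Sigma2 + kappa1 alpha gamma *: (- (2 *: Tm) + Sigma2)
      + (kappa2 alpha gamma cag * beta) *: (B^T *m B)) ->
  0 < c -> psd (S + 2^-1 *: Sigma1 - (2^-1 * c) *: Sigma1) ->
  (running_min (fun i => quad (Ghat B beta alpha gamma S Sigma1 T Sigma2)
                              (w i - w i.+1)) : nat -> R^o)
    =o_\oo (fun t => t%:R^-1 : R^o).
Proof.
move=> pP fP hP gP kkt C1 C2 sS sT TE Tp0 Tm0 beta0 D cR iter S0 _ T0 pdP.
move=> c0 Sc0.
have T0' := pd_psd T0.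
have [V [V0 VP]] := iPSPR_potential pP fP hP gP sS sT iter C1 C2 TE Tp0 Tm0
  beta0 D cR kkt S0 T0' pdP c0 Sc0.
apply: (running_min_littleo _ V0 VP) => k.
have [_ _ ag0] := and3P D.
by apply: Ghat_ge0 => //; exact: psd_half C1.1 S0.
Qed.
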